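(* For every non-discrete metrizable space $X$, the set of all metrics $d\in\mathrm{Met}(X)$ for which $(X,d)$ has rich pseudo-cones is a dense $G_\delta$ subset of $\mathrm{Met}(X)$.
   Context: For a metrizable space $X$, $\mathrm{Met}(X)$ denotes the set of all metrics on $X$ generating the topology of $X$, equipped with the topology generated by the $[0,\infty]$-valued metric $\mathcal{D}_X(d,e)=\sup_{(x,y)\in X^2}|d(x,y)-e(x,y)|$. Let $(X,d)$ be a metric space. A metric space $(P,d_P)$ is a pseudo-cone of $(X,d)$ if there exist a sequence $\{A_i\}_{i\in\mathbb{N}}$ of subsets of $X$ and a sequence $\{u_i\}_{i\in\mathbb{N}}$ in $(0,\infty)$ such that $\lim_{i\to\infty}\mathcal{GH}\big((A_i,u_i\cdot d|_{A_i^2}),(P,d_P)\big)=0$, where $\mathcal{GH}$ is the Gromov–Hausdorff distance. $\mathscr{P}(X,d)$ denotes the class of all pseudo-cones of $(X,d)$, and $\mathscr{F}$ the class of all finite metric spaces whose distances are rational numbers. $(X,d)$ has rich pseudo-cones if $\mathscr{F}$ is contained in $\mathscr{P}(X,d)$. *)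

(* Defs.v *)
From HB Require Import structures.
From mathcomp Require Import all_boot all_order all_algebra.
From mathcomp Require Import all_classical all_reals all_analysis.

Set Implicit Arguments.
Unset Strict Implicit.
Unset Printing Implicit Defensive.

Import Order.TTheory GRing.Theory Num.Theory.

Local Open Scope classical_set_scope.
Local Open Scope ring_scope.

Section metrics.
Context {R : realType}.

Definition is_metric (X : Type) (d : X -> X -> R) : Prop :=
  [/\ forall x, d x x = 0,
      forall x y, d x y = 0 -> x = y,
      forall x y, d x y = d y x &
      forall x y z, d x z <= d x y + d y z].

Definition generates_topology (X : topologicalType) (d : X -> X -> R) : Prop :=
  forall U : set X, open U <->
    (forall x, U x -> exists2 r, 0 < r & [set y | d x y < r] `<=` U).

End metrics.

Definition metrizable (R : realType) (X : topologicalType) : Prop :=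
  exists2 d : X -> X -> R, is_metric d & generates_topology d.

Definition discrete (X : topologicalType) : Prop := forall A : set X, open A.

Record Met (R : realType) (X : topologicalType) := MkMet {
  met_fun :> X -> X -> R ;
  met_is_metric : is_metric met_fun ;
  met_generates : generates_topology met_fun }.

HB.instance Definition _ R X := gen_eqMixin (Met R X).
HB.instance Definition _ R X := gen_choiceMixin (Met R X).

Section Met_topology.
Context {R : realType} {X : topologicalType}.
Implicit Types d e f : Met R X.

(* The supremum is taken in \bar R, so it is -oo (instead of 0) when X is
   empty; this does not affect the topology, as Met R X is then a singleton. *)
Definition met_dist d e : \bar R :=
  ereal_sup (range (fun xy : X * X => `|d xy.1 xy.2 - e xy.1 xy.2|%:E)).

Definition met_ball d (r : R) : set (Met R X) :=
  [set e | (met_dist d e < r%:E)%E].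

Let met_ent : set_system (Met R X * Met R X) := entourage_ met_ball.

Let met_nbhs d : set_system (Met R X) := nbhs_ met_ent d.

Let met_nbhsE : met_nbhs = nbhs_ met_ent. Proof. by []. Qed.

HB.instance Definition _ := hasNbhs.Build (Met R X) met_nbhs.

Let met_ball_center d (r : R) : 0 < r -> met_ball d r d.
Proof.
move=> r0; apply: (@le_lt_trans _ _ 0%E); last by rewrite lte_fin.
by apply: ge_ereal_sup => _ [xy _ <-]; rewrite subrr normr0.
Qed.

Let met_ball_sym d e (r : R) : met_ball d r e -> met_ball e r d.
Proof.
rewrite /met_ball /=; suff -> : met_dist d e = met_dist e d by [].
apply: (congr1 (fun g : X * X -> \bar R => ereal_sup (range g))).
by apply/funext => xy; rewrite distrC.
Qed.

Let met_ball_triangle d e f (r s : R) :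
  met_ball d r e -> met_ball e s f -> met_ball d (r + s) f.
Proof.
rewrite /met_ball /= => de ef; rewrite EFinD.
apply: (le_lt_trans _ (lteD de ef)).
apply: ge_ereal_sup => _ [xy _ <-].
apply: (@le_trans _ _ (`|d xy.1 xy.2 - e xy.1 xy.2|%:E +
                       `|e xy.1 xy.2 - f xy.1 xy.2|%:E)%E).
  by rewrite -EFinD lee_fin ler_distD.
by apply: leeD; apply: ereal_sup_ubound; exists xy.
Qed.

Let met_entE : met_ent = entourage_ met_ball. Proof. by []. Qed.

HB.instance Definition _ := @Nbhs_isPseudoMetric.Build R (Met R X)
  met_ent met_nbhsE met_ball met_ball_center met_ball_sym met_ball_triangle
  met_entE.

End Met_topology.

Section Gromov_Hausdorff.
Context {R : realType}.

Definition hausdorff_dist (Z : metricType R) (A B : set Z) : \bar R :=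
  ereal_inf [set r%:E | r in [set r : R | [/\ 0 < r,
    A `<=` \bigcup_(b in B) ball b r & B `<=` \bigcup_(a in A) ball a r]]].

Definition isometric_embedding (S : Type) (dS : S -> S -> R)
    (Z : metricType R) (i : S -> Z) : Prop :=
  forall x y, mdist (i x) (i y) = dS x y.

Definition gromov_hausdorff (S T : Type) (dS : S -> S -> R) (dT : T -> T -> R)
    : \bar R :=
  ereal_inf [set r | exists (Z : metricType R) (i : S -> Z) (j : T -> Z),
    [/\ isometric_embedding dS i, isometric_embedding dT j &
        r = hausdorff_dist (range i) (range j)]].

Definition scaled_restriction (X : Type) (d : X -> X -> R) (A : set X) (u : R) :
    {x | A x} -> {x | A x} -> R :=
  fun x y => u * d (sval x) (sval y).

Definition pseudo_cone (X : Type) (d : X -> X -> R) (P : metricType R) : Prop :=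
  exists (A : nat -> set X) (u : nat -> R), (forall i, 0 < u i) /\
    gromov_hausdorff (@scaled_restriction X d (A i) (u i)) (@mdist R P)
      @[i --> \oo] --> 0%E.

Definition finite_rational (P : metricType R) : Prop :=
  finite_set [set: P] /\ forall x y : P, exists q : rat, mdist x y = ratr q.

Definition rich_pseudo_cones (X : Type) (d : X -> X -> R) : Prop :=
  forall P : metricType R, finite_rational P -> pseudo_cone d P.

End Gromov_Hausdorff.

(* Main.v *)
Require Import Defs.
From mathcomp Require Import all_boot all_order all_algebra.
From mathcomp Require Import all_classical all_reals all_analysis.
From mathcomp Require Import borel_hierarchy.
From HB Require Import structures.
From mathcomp Require Import lra zify.

(** A finite space [P] is a pseudo-cone of [(X, d)] exactly when, for every
    tolerance, some family of points of [X] indexed by [P] has distances that,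
    after multiplication by a single positive factor, agree with those of [P] up
    to the tolerance ([pseudo_coneP]).  For a fixed tolerance this is a finite
    system of strict inequalities, hence an open condition on [d].  A finite
    space with rational distances is described by a rational matrix, so richness
    is a countable conjunction of open conditions ([rich_approx_seq]), and the
    set in question is a G-delta.

    Density is a Baire category argument, resting on the density of a single
    condition ([approx_copy_dense]).  Given a metric [e], a space [P] and
    [del > 0], fix a non-isolated point [a] and a scale [s] so small that the
    Kuratowski embedding of the rescaled space [s P] into a finite-dimensional
    sup-normed space has image of size at most [del].  Only then choose distinct
    points [x_i], one for each point of [P], so close to [a] that their mutual
    [e]-distances are negligible compared with [s].  Spreading the Kuratowski
    coordinates by Lipschitz bump functions centred at the [x_i] gives a map [F]
    from [X] to the sup-normed space with [F x_i] equal to the image of the i-th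
    point; then [e x y + |F x - F y|] is a metric between [e] and [e + del], it
    generates the same topology because [F] is [e]-Lipschitz, and on the [x_i]
    it is [s P] up to the negligible error.

    Because each perturbation only increases the metric, the completeness needed
    for the Baire argument is elementary: an increasing sequence of metrics with
    rapidly decreasing increments converges to its pointwise supremum, which
    again generates the topology ([met_increasing_limit]). *)

Set Implicit Arguments.
Unset Strict Implicit.
Unset Printing Implicit Defensive.

Import Order.TTheory GRing.Theory Num.Theory.

Local Open Scope classical_set_scope.
Local Open Scope ring_scope.

(** * The sup distance and the Kuratowski embedding *)

Section sup_distance.
Context {R : realType} {n : nat}.
Implicit Types v w z : 'I_n -> R.

Definition linf v w : R := \big[Num.max/0]_(q < n) `|v q - w q|.

Lemma linf_ge v w q : `|v q - w q| <= linf v w.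
Proof. exact: (le_bigmax 0 (fun q => `|v q - w q|) q). Qed.

Lemma linf_le v w c : 0 <= c -> (forall q, `|v q - w q| <= c) -> linf v w <= c.
Proof. by move=> c0 vwc; apply: bigmax_le. Qed.

Lemma linf_ge0 v w : 0 <= linf v w.
Proof. exact: bigmax_ge_id. Qed.

Lemma linfxx v : linf v v = 0.
Proof.
apply/eqP; rewrite eq_le linf_ge0 andbT; apply: linf_le => // q.
by rewrite subrr normr0.
Qed.

Lemma linf_sym v w : linf v w = linf w v.
Proof. by apply: eq_bigr => q _; rewrite distrC. Qed.

Lemma linf_triangle w v z : linf v z <= linf v w + linf w z.
Proof.
apply: linf_le => [|q]; first by rewrite addr_ge0 ?linf_ge0.
by rewrite (le_trans (ler_distD (w q) _ _))// lerD// linf_ge.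
Qed.

Lemma linf_eq0 v w : linf v w = 0 -> v = w.
Proof.
move=> vw0; apply/funext => q; apply/eqP; rewrite -subr_eq0 -normr_le0 -vw0.
exact: linf_ge.
Qed.

End sup_distance.

(** A named copy of the function type, so that the sup metric does not compete
    with the product topology on functions. *)
Definition linf_space (R : realType) (n : nat) : Type := 'I_n -> R.

HB.instance Definition _ R n := gen_eqMixin (linf_space R n).
HB.instance Definition _ R n := gen_choiceMixin (linf_space R n).
HB.instance Definition _ (R : realType) n := isMetric.Build R (linf_space R n)
  (@linfxx R n) (@linf_eq0 R n) (@linf_sym R n)
  (@linf_triangle R n).

Section metric_lemmas.
Context {R : realType} {X : Type} {d : X -> X -> R}.
Hypothesis d_metric : is_metric d.

Lemma metric_ge0 x y : 0 <= d x y.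
Proof.
by have [d0 _ ds dt] := d_metric; have := dt x y x; rewrite d0 (ds y x); lra.
Qed.

Lemma metric_scale u : 0 < u -> is_metric (fun x y => u * d x y).
Proof.
move=> u0; have [d0 d1 ds dt] := d_metric; split => [x|x y|x y|x y z].
- by rewrite d0 mulr0.
- by move/eqP; rewrite mulf_eq0 gt_eqF//= => /eqP /d1.
- by rewrite ds.
- by rewrite -mulrDr ler_pM2l.
Qed.

(** The triangle inequality bounds every coordinate by [d a (x j)], and
    coordinate [j] attains it. *)
Lemma linf_kuratowski n (x : 'I_n -> X) a j :
  linf (fun q => d a (x q)) (fun q => d (x j) (x q)) = d a (x j).
Proof.
have [d0 _ ds dt] := d_metric; apply/eqP; rewrite eq_le; apply/andP; split.
  apply: linf_le => [|q]; first exact: metric_ge0.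
  have := dt a (x j) (x q); have := dt (x j) a (x q); rewrite (ds (x j) a).
  by rewrite ler_norml; lra.
have := linf_ge (fun q => d a (x q)) (fun q => d (x j) (x q)) j.
by rewrite d0 subr0 ger0_norm// metric_ge0.
Qed.

End metric_lemmas.

Lemma mdist_is_metric (R : realType) (P : metricType R) : is_metric (@mdist R P).
Proof.
split; [exact: mdistxx|exact: mdist_positivity|exact: metric_sym|].
by move=> x y z; exact: metric_triangle.
Qed.

(** * Pseudo-cones that are finite *)

Definition approx_copy (R : realType) (X : Type) (d : X -> X -> R) n
    (D : 'I_n -> 'I_n -> R) (eta : R) :=
  exists (u : R) (x : 'I_n -> X),
    0 < u /\ forall i j, `|u * d (x i) (x j) - D i j| < eta.

Section pseudo_cones_of_finite_spaces.
Context {R : realType}.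

Lemma gromov_hausdorff_ge0 (S T : Type) (dS : S -> S -> R) (dT : T -> T -> R) :
  (0 <= gromov_hausdorff dS dT)%E.
Proof.
apply: le_ereal_inf_tmp => _ [Z [i [j [_ _ ->]]]].
by apply: le_ereal_inf_tmp => _ [r [r0 _ _] <-]; rewrite lee_fin ltW.
Qed.

(** Each point of [T] is matched with a point of [S] at distance less than [r] in
    a common ambient space; moving both ends of a segment by less than [r]
    changes its length by less than [2 * r]. *)
Lemma gromov_hausdorff_lt (S T : Type) (dS : S -> S -> R) (dT : T -> T -> R)
    (r : R) :
  (gromov_hausdorff dS dT < r%:E)%E ->
  exists f : T -> S, forall p q, `|dS (f p) (f q) - dT p q| < 2 * r.
Proof.
move=> /ereal_inf_lt[_ [Z [i [j [iS jT ->]]]]].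
move=> /ereal_inf_lt[_ [s [s0 _ TS] <-]]; rewrite lte_fin => sr.
have nearby p : exists a, mdist (i a) (j p) < s.
  have [_ [a _ <-]] := TS (j p) (ex_intro2 _ _ p I erefl).
  by rewrite ballEmdist; exists a.
have [f fs] := choice nearby; exists f => p q.
have := fs p; have := fs q; rewrite -iS -jT ltr_norml.
have := metric_triangle (i (f p)) (j p) (i (f q)).
have := metric_triangle (j p) (j q) (i (f q)).
have := metric_triangle (j p) (i (f p)) (j q).
have := metric_triangle (i (f p)) (i (f q)) (j q).
rewrite (metric_sym (j p) (i (f p))) (metric_sym (j q) (i (f q))).
by lra.
Qed.

(** The Kuratowski embeddings of [range x] and of [P], both with coordinates
    indexed by ['I_n], take values in the same space, and send [x i] and [e i] to
    vectors whose coordinates differ by less than [eta].  This avoids gluing the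
    two spaces along a correspondence. *)
Lemma gromov_hausdorff_le (X : Type) (d : X -> X -> R) (P : metricType R) n
    (e : 'I_n -> P) (x : 'I_n -> X) (u eta : R) :
  is_metric d -> (forall p, exists i, e i = p) -> 0 < u -> 0 < eta ->
  (forall i j, `|u * d (x i) (x j) - mdist (e i) (e j)| < eta) ->
  (gromov_hausdorff (@scaled_restriction R X d (range x) u) (@mdist R P)
    <= eta%:E)%E.
Proof.
move=> dm e_surj u0 eta0 xeta.
pose i (a : {z | range x z}) : linf_space R n := fun q => u * d (sval a) (x q).
pose j (p : P) : linf_space R n := fun q => mdist p (e q).
have ij k a : sval a = x k -> linf (i a) (j (e k)) < eta.
  move=> ak; apply: bigmax_lt => // q _.
  by rewrite /i ak.
apply: (@le_trans _ _ (hausdorff_dist (range i) (range j))).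
  apply: ge_ereal_inf; eexists; last exact: lexx.
  exists (linf_space R n), i, j; split=> //.
  - move=> a b; have [k _ xk] := svalP b.
    change (linf (i a) (i b) = u * d (sval a) (sval b)).
    rewrite /i -xk; exact: (linf_kuratowski (metric_scale dm u0)).
  - move=> p q; have [k <-] := e_surj q.
    exact: (linf_kuratowski (@mdist_is_metric R P)).
apply: ge_ereal_inf; exists eta%:E => //; exists eta => //; split=> //.
- move=> _ [a _ <-]; have [k _ ka] := svalP a.
  exists (j (e k)); first by exists (e k).
  by rewrite ballEmdist/= metric_sym; apply: ij.
- move=> _ [p _ <-]; have [k <-] := e_surj p.
  have xk : range x (x k) by exists k.
  exists (i (exist _ _ xk)); first by exists (exist _ _ xk).
  by rewrite ballEmdist/=; apply: ij.
Qed.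

(** A finite space is seen through a surjective enumeration [e], with repetitions
    allowed; tolerances of the form [1 / (k + 1)] keep the family of conditions
    countable. *)
Lemma pseudo_coneP (X : Type) (d : X -> X -> R) (P : metricType R) n
    (e : 'I_n -> P) : is_metric d -> (forall p, exists i, e i = p) ->
  pseudo_cone d P <->
  forall k, approx_copy d (fun i j => mdist (e i) (e j)) k.+1%:R^-1.
Proof.
move=> dm e_surj; split.
  move=> [A [u [u0 cvgGH]]] k.
  have k2 : 0 < k.+1%:R^-1 / 2 :> R by rewrite divr_gt0// invr_gt0 ltr0n.
  have [N _ /(_ N (leqnn N))/=] :=
    cvgGH _ (@nbhs_open_ereal_lt R 0 (fun=> k.+1%:R^-1 / 2) k2).
  move=> /gromov_hausdorff_lt[f fk].
  exists (u N), (fun i => sval (f (e i))); split=> // i j.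
  by have := fk (e i) (e j); rewrite mulrC divfK.
move=> /choice[u /choice[x uxP]].
exists (fun k => range (x k)), u; split; first by move=> k; have [] := uxP k.
apply: (squeeze_cvge _ (@cvg_cst _ 0%E _ _ _) (@cvge_harmonic R)).
apply: nearW => k; rewrite gromov_hausdorff_ge0/=.
have [u0 xk] := uxP k; exact: gromov_hausdorff_le.
Qed.

Lemma finite_enum (P : metricType R) : finite_set [set: P] ->
  exists n (e : 'I_n -> P), forall p, exists i, e i = p.
Proof.
move=> /finite_seqP[s sP]; exists (size s), (tnth (in_tuple s)) => p.
have /tnthP[i ->] : p \in in_tuple s by have : [set` s] p by rewrite -sP.
by exists i.
Qed.

End pseudo_cones_of_finite_spaces.

(** * The space of metrics *)

Section metrics_on_a_space.
Context {R : realType} {X : topologicalType}.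
Implicit Types d e : Met R X.

(** Openness for the sup distance, phrased with pointwise real inequalities
    rather than with a supremum in the extended reals. *)
Definition uniformly_open (S : set (Met R X)) := forall d, S d ->
  exists2 r : R, 0 < r &
    forall e : Met R X, (forall x y, `|d x y - e x y| <= r) -> S e.

(** Density with approximants that only increase the metric.  A function above a
    metric that generates the topology separates points, and its balls are
    contained in those of the smaller metric; hence a limit of increasing
    approximants generates the topology as soon as it is continuous. *)
Definition dense_above (S : set (Met R X)) := forall d (r : R), 0 < r ->
  exists2 e : Met R X, S e & forall x y, d x y <= e x y <= d x y + r.

Lemma uniformly_open_open (S : set (Met R X)) : uniformly_open S -> open S.
Proof.
move=> So; rewrite openE => d /So[r r0 rS]; apply/nbhs_ballP; exists r => //.
move=> e de; apply: rS => x y; rewrite -lee_fin; apply: ltW.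
apply: le_lt_trans de; apply: ereal_sup_ubound.
by exists (x, y).
Qed.

Lemma dense_of_near (S : set (Met R X)) :
  (forall d (r : R), 0 < r -> exists2 e, S e & forall x y, `|d x y - e x y| <= r) ->
  dense S.
Proof.
move=> Sd O [d Od] oO.
have /nbhs_ballP[r/= r0 rO] : nbhs d O by apply: open_nbhs_nbhs; split.
have [e Se de] := Sd d (r / 2) (divr_gt0 r0 (ltr0Sn R 1)).
exists e; split=> //; apply: rO.
apply: (@le_lt_trans _ _ (r / 2)%:E); last by rewrite lte_fin; lra.
by apply: ge_ereal_sup => _ [xy _ <-]; rewrite lee_fin.
Qed.

Lemma generates_of_le (d e : X -> X -> R) : is_metric d -> is_metric e ->
  generates_topology d -> (forall x y, d x y <= e x y) ->
  (forall x r, 0 < r -> exists2 s, 0 < s & forall y, d x y < s -> e x y < r) ->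
  generates_topology e.
Proof.
move=> dm em dX de ed U; split=> [/dX oU x /oU[r r0 rU]|eU].
  by exists r => // y /= exy; apply: rU; apply: le_lt_trans (de x y) exy.
apply/dX => x /eU[r r0 rU]; have [s s0 sr] := ed x r r0.
by exists s => // y /sr; exact: rU.
Qed.

Lemma met_continuous d e x r : 0 < r ->
  exists2 s, 0 < s & forall y, d x y < s -> e x y < r.
Proof.
move=> r0; have [em0 _ _ et] := met_is_metric e.
have : open [set y | e x y < r].
  apply/(met_generates e) => y /= xyr; exists (r - e x y); first by rewrite subr_gt0.
  by move=> z /= yz; have := et x y z; lra.
move=> /(met_generates d)/(_ x)[|s s0 sr]; first by rewrite /= em0.
by exists s.
Qed.

(** The increments after stage [n] add up to at most [del n], so the pointwise
    supremum is within [del n] of [E n].  It dominates [E 0], and it is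
    continuous as a uniform limit of continuous metrics. *)
Lemma met_increasing_limit (E : nat -> Met R X) (del : nat -> R) :
  (forall n, 0 < del n) -> (forall n, del n.+1 <= del n / 2) ->
  (forall n x y, E n x y <= E n.+1 x y <= E n x y + del n / 2) ->
  exists d, forall n x y, E n x y <= d x y <= E n x y + del n.
Proof.
move=> del0 del2 EE.
(* Subtracting [del (n + k)] makes the telescoping bound inductive. *)
have Emono n k x y : E n x y <= E (n + k)%N x y <= E n x y + del n - del (n + k)%N.
  elim: k => [|k /andP[IH1 IH2]]; first by rewrite addn0 addrK lexx.
  have /andP[] := EE (n + k)%N x y; have := del2 (n + k)%N; rewrite addnS.
  by lra.
have Ebound n m x y : E m x y <= E n x y + del n.
  have [nm|/ltnW mn] := leqP n m.
    have /andP[_] := Emono n (m - n)%N x y; rewrite subnKC//.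
    by have := del0 m; lra.
  have /andP[+ _] := Emono m (n - m)%N x y; rewrite subnKC//.
  by have := del0 n; lra.
pose d x y := sup (range (fun n => E n x y)).
have E_le_d n x y : E n x y <= d x y.
  have bounded : has_ubound (range (fun m => E m x y)).
    by exists (E 0%N x y + del 0%N) => _ [m _ <-].
  by apply: (ub_le_sup bounded); exists n.
have d_le c x y : (forall n, E n x y <= c) -> d x y <= c.
  move=> Ec; apply: ge_sup; first by exists (E 0%N x y), 0%N.
  by move=> _ [m _ <-].
have dE n x y : d x y <= E n x y + del n by exact: d_le.
have d_metric : is_metric d.
  split => [x|x y dxy|x y|x y z].
  - apply/eqP; rewrite eq_le; apply/andP; split.
      by apply: d_le => n; have [-> _ _ _] := met_is_metric (E n).
    by apply: le_trans (E_le_d 0%N x x); have [-> _ _ _] := met_is_metric (E 0%N).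
  - have [_ E1 _ _] := met_is_metric (E 0%N); apply: E1; apply/eqP.
    rewrite eq_le (metric_ge0 (met_is_metric _)) andbT.
    by have := E_le_d 0%N x y; rewrite dxy.
  - rewrite /d; suff -> : (fun n => E n x y) = (fun n => E n y x) by [].
    apply/funext => n.
    by have [_ _ -> _] := met_is_metric (E n).
  - apply: d_le => n; have [_ _ _ /(_ x y z)] := met_is_metric (E n).
    by move/le_trans; apply; apply: lerD.
have del_small r : 0 < r -> exists n, del n < r.
  move=> r0.
  (* Halving beats the growth of [n + 1], so the Archimedean property suffices. *)
  have deln n : n.+1%:R * del n <= del 0%N.
    elim: n => [|n]; first by rewrite mul1r.
    apply: le_trans; rewrite -natr1.
    have : 1 <= n.+1%:R :> R by rewrite ler1n.
    by have := del2 n; have := del0 n; nra.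
  have := truncnS_gt (del 0%N / r).
  set n := Num.Def.truncn _; rewrite ltr_pdivrMr// => nr.
  exists n; rewrite -(@ltr_pM2l _ n.+1%:R) ?ltr0n//.
  exact: le_lt_trans nr.
have d_gen : generates_topology d.
  apply: (generates_of_le (met_is_metric (E 0%N)) d_metric (met_generates _)).
    exact: E_le_d.
  move=> x r r0; have [n nr] := del_small (r / 2) (divr_gt0 r0 (ltr0Sn R 1)).
  have [s s0 sr] := met_continuous (E 0%N) (E n) x (divr_gt0 r0 (ltr0Sn R 1)).
  exists s => // y /sr Er; have := dE n x y.
  by lra.
exists (MkMet d_metric d_gen) => n x y /=.
by rewrite E_le_d dE.
Qed.

(** The nested balls of Baire's theorem: stage [n] moves the metric up into [U n]
    by at most half of the allowed radius, then shrinks the radius so that the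
    ball around the new metric stays inside [U n]. *)
Lemma met_baire (U : nat -> set (Met R X)) :
  (forall n, uniformly_open (U n)) -> (forall n, dense_above (U n)) ->
  forall d (r : R), 0 < r -> exists2 e, (forall n, U n e) &
    forall x y, `|d x y - e x y| <= r.
Proof.
move=> Uopen Udense d r r0.
(* A state consists of a metric and the radius still allowed around it. *)
have step (p : nat * (Met R X * R)) : exists q : Met R X * R, 0 < p.2.2 ->
    [/\ 0 < q.2, q.2 <= p.2.2 / 2,
      forall x y, p.2.1 x y <= q.1 x y <= p.2.1 x y + p.2.2 / 2 &
      forall e, (forall x y, `|q.1 x y - e x y| <= q.2) -> U p.1 e].
  case: p => n [e s] /=.
  have [s0|s0] := ltP 0 s; last by exists (e, s).
  have s20 : 0 < s / 2 by lra.
  have [e' Ue' ee'] := Udense n e _ s20.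
  have [t t0 tU] := Uopen n e' Ue'.
  exists (e', Num.min t (s / 2)) => _ /=; split=> //.
  - by rewrite lt_min t0.
  - by rewrite ge_min lexx orbT.
  - by move=> f ff; apply: tU => x y; rewrite (le_trans (ff x y))// ge_min lexx.
have [g gP] := choice step.
pose p := fix p n : Met R X * R := if n is m.+1 then g (m, p m) else (d, r).
have p0 n : 0 < (p n).2 by elim: n => [//|n IH] /=; have [] := gP (n, p n) IH.
have pP n := gP (n, p n) (p0 n).
have [] := @met_increasing_limit (fun n => (p n).1) (fun n => (p n).2).
- exact: p0.
- by move=> n; have [] := pP n.
- by move=> n; have [] := pP n.
move=> e eP; exists e => [n|x y]; last first.
  by have /= := eP 0%N x y; rewrite ler_norml; lra.
have [_ _ _] := pP n; apply=> x y.
by have /= := eP n.+1 x y; rewrite ler_norml; lra.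
Qed.

(** * Inserting a scaled copy of a finite space near a non-isolated point *)

(** The pullback of the sup distance by a Lipschitz map is a continuous
    pseudometric, so adding it does not change the topology. *)
Lemma met_add_lipschitz (e : Met R X) n (F : X -> 'I_n -> R) (L : R) :
  0 <= L -> (forall x y q, `|F x q - F y q| <= L * e x y) ->
  exists e' : Met R X, forall x y, e' x y = e x y + linf (F x) (F y).
Proof.
move=> L0 FL; pose d x y := e x y + linf (F x) (F y).
have [e0 e1 es et] := met_is_metric e; have e_ge0 := metric_ge0 (met_is_metric e).
have d_metric : is_metric d.
  split => [x|x y dxy|x y|x y z].
  - by rewrite /d e0 linfxx addr0.
  - apply: e1; have := e_ge0 x y; have := linf_ge0 (F x) (F y).
    by move: dxy; rewrite /d; lra.
  - by rewrite /d es linf_sym.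
  - have := et x y z; have := linf_triangle (F y) (F x) (F z).
    by rewrite /d; lra.
suff d_gen : generates_topology d by exists (MkMet d_metric d_gen).
apply: (generates_of_le (met_is_metric e) d_metric (met_generates e)).
  by move=> x y; rewrite lerDl linf_ge0.
move=> x r r0; have L1 : 0 < 1 + L by lra.
exists (r / (1 + L)) => [|y]; first exact: divr_gt0.
rewrite ltr_pdivlMr// => exy.
have : linf (F x) (F y) <= L * e x y.
  by apply: linf_le => [|q]; [exact: mulr_ge0|exact: FL].
by rewrite /d; lra.
Qed.

(** Carrying the separation [r] from [a] itself through the induction guarantees
    that a new point within [r / 2] of [a] is at least [r / 2] away from the
    previous ones. *)
Lemma separated_points (e : Met R X) (a : X) n (eta : R) : ~ open [set a] -> 0 < eta ->
  exists (x : nat -> X) (r : R), [/\ 0 < r,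
    forall i, (i < n)%N -> r <= e a (x i) < eta &
    forall i j, (i < n)%N -> (j < n)%N -> i != j -> r <= e (x i) (x j)].
Proof.
have [e0 e1 es et] := met_is_metric e; have e_ge0 := metric_ge0 (met_is_metric e).
move=> a_open eta0; elim: n => [|n [x [r [r0 xa xx]]]].
  by exists (fun=> a), 1; split.
pose s := Num.min (r / 2) eta.
have [y ya ys] : exists2 y, y <> a & e a y < s.
  apply: contrapT => ny; apply: a_open; apply/(met_generates e) => _ ->.
  exists s => [|y ys]; first by rewrite lt_min eta0 andbT; lra.
  by apply: contrapT => ya; apply: ny; exists y.
have ay : 0 < e a y.
  by rewrite lt_neqAle e_ge0 andbT; apply/eqP => /esym/e1/esym.
move: ys; rewrite lt_min => /andP[yr yeta].
have far i : (i < n)%N -> r / 2 <= e (x i) y.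
  by move=> /xa; have := et a y (x i); rewrite (es y (x i)); lra.
have [t [t0 tr ty]] : exists t, [/\ 0 < t, t <= r / 2 & t <= e a y].
  exists (Num.min (r / 2) (e a y)); rewrite !ge_min !lexx orbT lt_min ay.
  by split=> //; lra.
exists (fun i => if (i < n)%N then x i else y), t; split=> // [i _|i j].
  by case: ifPn => [/xa|_]; lra.
rewrite !ltnS => ilt jlt ij.
case: ifPn => [iin|nin]; case: ifPn => [jn|njn].
- by have := xx i j iin jn ij; lra.
- by have := far i iin; lra.
- by have := far j jn; rewrite (es y (x j)); lra.
- by move: ij; rewrite neq_ltn; lia.
Qed.

(** The scale [s] is fixed by [del] before the points are chosen, which lets the
    points be as close together as the tolerance [s * eta] demands. *)
Lemma approx_copy_dense (P : metricType R) n (p : 'I_n -> P) (e : Met R X) (a : X)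
    (del eta : R) : ~ open [set a] -> 0 < del -> 0 < eta ->
  exists2 e' : Met R X, approx_copy e' (fun i j => mdist (p i) (p j)) eta &
    forall x y, e x y <= e' x y <= e x y + del.
Proof.
move=> a_open del0 eta0.
have [e0 e1 es et] := met_is_metric e; have e_ge0 := metric_ge0 (met_is_metric e).
pose D i j := mdist (p i) (p j).
pose C := \sum_i \sum_j D i j.
have D0 i j : 0 <= D i j by exact: mdist_ge0.
have DC i : \sum_j D i j <= C.
  rewrite /C [leRHS](bigD1 i)//= lerDl.
  by apply: sumr_ge0 => k _; exact: sumr_ge0.
have C0 : 0 <= C by apply: sumr_ge0 => i _; exact: sumr_ge0.
(* Adding 1 keeps the denominator positive when all distances vanish. *)
pose s := del / (1 + C).
have s0 : 0 < s by rewrite divr_gt0//; lra.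
have sC : s * C <= del.
  by rewrite /s mulrAC ler_pdivrMr; nra.
have [x [r [r0 xa xx]]] := @separated_points e a n (s * eta / 2) a_open
  ltac:(rewrite divr_gt0// mulr_gt0//).
pose bump k y := Num.max 0 (1 - e y (x k) / r).
have bump_val i k : (i < n)%N -> (k < n)%N -> bump k (x i) = (i == k)%:R.
  move=> iin kn; rewrite /bump; have [->|ik] := eqVneq i k.
    by rewrite e0 mul0r subr0; apply/max_idPr.
  apply/max_idPl; rewrite subr_le0 ler_pdivlMr// mul1r; exact: xx.
have bump_lip k y z : `|bump k y - bump k z| <= e y z / r.
  have : `|(1 - e y (x k) / r) - (1 - e z (x k) / r)| <= e y z / r.
    rewrite (_ : _ - _ = (e z (x k) - e y (x k)) / r); last by rewrite mulrBl; lra.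
    rewrite normrM (gtr0_norm (_ : 0 < r^-1)) ?invr_gt0// ler_pM2r ?invr_gt0//.
    have := et y z (x k); have := et z y (x k); rewrite (es z y) ler_norml; lra.
  rewrite /bump /Num.max.
  by case: ltP => b1; case: ltP => b2; rewrite !ler_norml => /andP[b3 b4]; lra.
have bump_le k y z : `|bump k y - bump k z| <= 1.
  have b w : 0 <= bump k w <= 1.
    rewrite /bump le_max lexx/= ge_max ler01/= lerBlDr lerDl.
    by rewrite divr_ge0 // ltW.
  by have := b y; have := b z; rewrite ler_norml; lra.
pose F y q := s * \sum_(i < n) D q i * bump i y.
(* Used with [c = e y z / r] for the Lipschitz bound on [F], and with [c = 1]
   for the bound on its oscillation. *)
have Fdiff y z q c : 0 <= c ->
    (forall i, `|bump i y - bump i z| <= c) -> `|F y q - F z q| <= del * c.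
  move=> c0 bc; apply: le_trans (_ : s * C * c <= _); last by rewrite ler_wpM2r.
  rewrite /F -mulrBr normrM gtr0_norm// -mulrA ler_pM2l//.
  rewrite -sumrB (le_trans (ler_norm_sum _ _ _))//.
  apply: le_trans (_ : (\sum_i D q i) * c <= _); last by rewrite ler_wpM2r.
  rewrite mulr_suml; apply: ler_sum => i _.
  by rewrite -mulrBr normrM ger0_norm// ler_wpM2l.
have [||e' e'E] := @met_add_lipschitz e n F (del / r).
- by rewrite divr_ge0// ltW.
- move=> y z q; rewrite mulrAC -mulrA; apply: Fdiff => //.
  by rewrite divr_ge0// ltW.
have Fx (i j : 'I_n) : linf (F (x i)) (F (x j)) = s * D i j.
  have FxE (k : 'I_n) : F (x k) = fun q => s * D k q.
    apply/funext => q; congr (_ * _).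
    rewrite (bigD1 k)//= big1 ?addr0 => [|l lk].
      by rewrite bump_val// eqxx mulr1 /D metric_sym.
    by rewrite bump_val// eq_sym (_ : (_ == _) = false) ?mulr0//; apply/negbTE.
  rewrite !FxE.
  exact: (linf_kuratowski (metric_scale (@mdist_is_metric R P) s0)).
exists e' => [|y z]; last first.
  rewrite e'E lerDl linf_ge0 lerD2l; apply: linf_le => [|q]; first exact: ltW.
  by have := Fdiff y z q 1 ler01 (fun i => bump_le i y z); rewrite mulr1.
exists s^-1, (fun i : 'I_n => x i); split; first by rewrite invr_gt0.
move=> i j; rewrite e'E Fx mulrDr mulrA mulVf ?gt_eqF// mul1r addrK.
rewrite ger0_norm ?mulr_ge0 ?invr_ge0 ?(ltW s0)//.
rewrite mulrC ltr_pdivrMr//.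
have := xa i (ltn_ord i); have := xa j (ltn_ord j).
have := et (x i) a (x j); rewrite (es (x i) a).
by lra.
Qed.

(** A finite family of strict inequalities has a uniform slack [eta - c]. *)
Lemma approx_copy_open (d : Met R X) n (D : 'I_n -> 'I_n -> R) (eta : R) :
  0 < eta -> approx_copy d D eta ->
  exists2 r, 0 < r & forall e : Met R X, (forall x y, `|d x y - e x y| <= r) ->
    approx_copy e D eta.
Proof.
move=> eta0 [u [x [u0 xD]]].
pose c := \big[Num.max/0]_(ij : 'I_n * 'I_n)
  `|u * d (x ij.1) (x ij.2) - D ij.1 ij.2|.
have c_lt : c < eta by apply: bigmax_lt => // ij _; exact: xD.
have c_ge i j : `|u * d (x i) (x j) - D i j| <= c.
  by apply: (le_bigmax 0 (fun ij : 'I_n * 'I_n =>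
    `|u * d (x ij.1) (x ij.2) - D ij.1 ij.2|) (i, j)).
exists ((eta - c) / (2 * u)) => [|e de]; first by rewrite divr_gt0//; nra.
exists u, x; split=> // i j.
have := de (x i) (x j); rewrite ler_pdivlMr; last by nra.
have -> : `|d (x i) (x j) - e (x i) (x j)| * (2 * u) =
          `|u * d (x i) (x j) - u * e (x i) (x j)| * 2.
  by rewrite -mulrBr normrM (gtr0_norm u0); lra.
have := ler_distD (u * d (x i) (x j)) (u * e (x i) (x j)) (D i j).
rewrite (distrC (u * e _ _) (u * d _ _)).
by have := c_ge i j; lra.
Qed.

(** * Richness as a countable intersection *)

Definition realized n (M : 'M[rat]_n) := exists (P : metricType R) (p : 'I_n -> P),
  (forall q, exists i, p i = q) /\ forall i j, mdist (p i) (p j) = ratr (M i j).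

(** The guard [realized] discards the rational matrices that are not distance
    matrices: their conditions would fail for small tolerances; thus a countable
    index type can be used without enumerating the finite metric spaces. *)
Definition approx_set (c : {n : nat & 'M[rat]_n} * nat) : set (Met R X) :=
  [set d | realized (tagged c.1) ->
    approx_copy d (fun i j => ratr (tagged c.1 i j) : R) c.2.+1%:R^-1].

Lemma rich_pseudo_conesP (d : Met R X) :
  rich_pseudo_cones d <-> forall c, approx_set c d.
Proof.
split=> [rich [[n M] k] /= [P [p [p_surj pM]]]|all_approx P [Pfin Prat]].
  have /rich : finite_rational P.
    split; last first.
      by move=> q q'; have [i <-] := p_surj q; have [j <-] := p_surj q'; exists (M i j).
    have -> : [set: P] = p @` [set: 'I_n].
      by apply/seteqP; split=> // q _; have [i <-] := p_surj q; exists i.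
    by apply: finite_image; exact: finite_finset.
  move=> /(pseudo_coneP (met_is_metric d) p_surj)/(_ k).
  by congr approx_copy; apply/funext => i; apply/funext => j.
have [n [p p_surj]] := finite_enum Pfin.
have [f fP] := choice (fun ij : 'I_n * 'I_n => Prat (p ij.1) (p ij.2)).
pose M : 'M[rat]_n := \matrix_(i, j) f (i, j).
have pM i j : mdist (p i) (p j) = ratr (M i j) by rewrite mxE -fP.
apply/(pseudo_coneP (met_is_metric d) p_surj) => k.
have /= := all_approx (Tagged (fun n => 'M[rat]_n) M, k).
move=> /(_ (ex_intro _ P (ex_intro _ p (conj p_surj pM)))).
by congr approx_copy; apply/funext => i; apply/funext => j.
Qed.

Lemma approx_set_open c : uniformly_open (approx_set c).
Proof.
move=> d dc; have [Mr|nMr] := pselect (realized (tagged c.1)); last first.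
  by exists 1 => // e _ /nMr.
have k0 : 0 < c.2.+1%:R^-1 :> R by rewrite invr_gt0 ltr0n.
have [r r0 rP] := approx_copy_open k0 (dc Mr).
by exists r => // e de _; exact: rP.
Qed.

Lemma approx_set_dense (a : X) c : ~ open [set a] -> dense_above (approx_set c).
Proof.
move=> a_open d r r0; have [[P [p [_ pM]]]|nMr] := pselect (realized (tagged c.1)).
  have [|e ep de] := @approx_copy_dense P _ p d a r c.2.+1%:R^-1 a_open r0.
    by rewrite invr_gt0 ltr0n.
  exists e => // _; move: ep; congr approx_copy.
  by apply/funext => i; apply/funext => j.
exists d; first by move=> /nMr.
by move=> x y; lra.
Qed.

Definition approx_seq (n : nat) : set (Met R X) :=
  if unpickle n is Some c then approx_set c else setT.

Lemma rich_approx_seq :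
  [set d : Met R X | rich_pseudo_cones d] = \bigcap_n approx_seq n.
Proof.
apply/seteqP; split=> [d /rich_pseudo_conesP dc n _|d dn].
  by rewrite /approx_seq; case: unpickle.
apply/rich_pseudo_conesP => c.
by have := dn (pickle c) I; rewrite /approx_seq pickleK.
Qed.

Lemma nonisolated_point : metrizable R X -> ~ discrete X ->
  exists a : X, ~ open [set a].
Proof.
move=> [d dm dX] nX; apply: contrapT => no; apply: nX => A; apply/dX => x Ax.
have /dX/(_ x erefl)[r r0 rx] : open [set x].
  by apply: contrapT => nx; apply: no; exists x.
by exists r => // y /rx ->.
Qed.

End metrics_on_a_space.

Theorem theorem4p15 (R : realType) (X : topologicalType)
    (X_metrizable : metrizable R X) (X_nondiscrete : ~ discrete X) :
  dense [set d : Met R X | rich_pseudo_cones d] /\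
  Gdelta [set d : Met R X | rich_pseudo_cones d].
Proof.
have [a a_open] := nonisolated_point X_metrizable X_nondiscrete.
have open_n n : uniformly_open (@approx_seq R X n).
  rewrite /approx_seq; case: unpickle => [c|d _]; first exact: approx_set_open.
  by exists 1.
have dense_n n : dense_above (@approx_seq R X n).
  rewrite /approx_seq; case: unpickle => [c|d r r0].
    exact: approx_set_dense a_open.
  by exists d => // x y; lra.
rewrite rich_approx_seq; split.
  apply: dense_of_near => d r r0.
  have [e en de] := met_baire open_n dense_n d r0.
  by exists e => // n _; exact: en.
by exists approx_seq => // n; apply: uniformly_open_open; exact: open_n.
Qed.
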